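(* Let $I\subset\mathbb{R}$ be a closed interval, $f,g:I\to I$, and $p\in[0,1]$. Suppose there is a finite set $A=\{a_1,\ldots,a_m\}\subset I$ such that for every starting point $x\in I$, $$\lim_{n\to\infty}P(x_n\in A)=1 .$$ Then $\mu(f,g,p)=0$.
   Context: $I$ is a closed bounded interval of length $|I|>0$. For maps $f,g:I\to I$ and $p\in[0,1]$, consider the random dynamical system in which at each step, independently, $f$ is applied with probability $p$ and $g$ with probability $1-p$. Formally, $\Omega=\{f,g\}^{\infty}$ carries the product probability measure $P$ under which the coordinates $\omega_1,\omega_2,\ldots$ are independent with $P(\omega_i=f)=p$, $P(\omega_i=g)=1-p$ ($f$ and $g$ being treated as two distinct symbols). For $x\in I$ the trajectory is $x_0=x$, $x_n(\omega)=\omega_n\circ\omega_{n-1}\circ\cdots\circ\omega_1(x)$. For two starting points $x,y\in I$ the trajectories $x_n$ and $y_n$ are driven by the same $\omega$. Define, for $n\ge 1$ and $t\in\mathbb{R}$, $$F_{xy}^{(n)}(t)=\frac1n\sum_{i=0}^{n-1}P(|x_i-y_i|<t),\quad F_{xy}(t)=\liminf_{n\to\infty}F_{xy}^{(n)}(t),\quad F_{xy}^\star(t)=\limsup_{n\to\infty}F_{xy}^{(n)}(t),$$ and the measure of (distributional) chaos $$\mu(f,g,p)=\sup_{x,y\in I}\frac1{|I|}\int_0^{|I|}\bigl(F_{xy}^\star(t)-F_{xy}(t)\bigr)\,\mathrm{d}t .$$ *)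

(* Defs.v *)
From HB Require Import structures.
From mathcomp Require Import all_boot all_order all_algebra finmap.
From mathcomp Require Import all_classical all_reals all_analysis measurable_realfun.
From mathcomp Require Import ring lra.

Set Implicit Arguments.
Unset Strict Implicit.
Unset Printing Implicit Defensive.

Import Order.TTheory GRing.Theory Num.Theory.
Import numFieldNormedType.Exports.

Local Open Scope classical_set_scope.
Local Open Scope ring_scope.

(* The sequence space {f, g}^oo with its product sigma-algebra: the symbol f is
   encoded by true and g by false, so that f and g stay distinct symbols even
   when they are equal as maps. The coordinate omega_(n.+1) is w n. *)
Definition coordinate_events : set (set (nat -> bool)) :=
  [set C | exists (i : nat) (s : bool), C = [set w | w i = s]].

Definition Omega := g_sigma_algebraType coordinate_events.

Section Chaos.
Context {R : realType}.

(* Every subset of bool is an event for a single coordinate. *)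
Definition independent_coordinates (P : probability Omega R) : Prop :=
  forall (J : {fset nat}) (B : nat -> set bool),
    P [set w : Omega | forall i, i \in J -> B i (w i)]
    = (\prod_(i <- J) P [set w : Omega | B i (w i)])%E.

(* P is the product measure with P(omega_i = f) = p, P(omega_i = g) = 1 - p. *)
Definition is_bernoulli_product (p : R) (P : probability Omega R) : Prop :=
  independent_coordinates P /\
  forall i, P [set w : Omega | w i = true] = p%:E /\
            P [set w : Omega | w i = false] = (1 - p)%:E.

Fixpoint trajectory (f g : R -> R) (w : Omega) (x : R) (n : nat) : R :=
  if n is m.+1 then (if w m then f else g) (trajectory f g w x m) else x.

(* The value at n = 0 is 0; it is irrelevant for the limits. *)
Definition Fn (f g : R -> R) (P : probability Omega R) (x y : R) (n : nat)
    (t : R) : \bar R :=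
  ((n%:R^-1)%:E * \sum_(0 <= i < n)
     P [set w : Omega | `|trajectory f g w x i - trajectory f g w y i| < t]%R)%E.

Definition Flow (f g : R -> R) (P : probability Omega R) (x y t : R) : \bar R :=
  limn_einf (fun n => Fn f g P x y n t).

Definition Fstar (f g : R -> R) (P : probability Omega R) (x y t : R) : \bar R :=
  limn_esup (fun n => Fn f g P x y n t).

Definition chaos_measure (a b : R) (f g : R -> R) (P : probability Omega R)
    : \bar R :=
  ereal_sup [set r | exists x y : R, [/\ x \in `[a, b], y \in `[a, b] &
    r = (((b - a)^-1)%:E *
         \int[lebesgue_measure]_(t in `[0%R, (b - a)%R])
           (Fstar f g P x y t - Flow f g P x y t))%E]].

End Chaos.

Section Existence.
Context {R : realType} (p : R).
Hypothesis p01 : 0 <= p <= 1.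

(* The digits of u in [0, 1[ in base p, i.e. the itinerary of u under the map
   sending [0, p[ and [p, 1[ affinely onto [0, 1[; under the uniform law they
   are independent with the required marginals. *)
Let T (u : R) := if u < p then p^-1 * u else (1 - p)^-1 * (u - p).
Let digits (u : R) : Omega := fun i => iter i T u < p.
Let q (s : bool) := if s then p else 1 - p.

Let measurable_coordinate i (B : set bool) :
  measurable [set w : Omega | B (w i)].
Proof.
have h s : measurable [set w : Omega | w i = s].
  by apply: sub_sigma_algebra; exists i, s.
suff -> : [set w : Omega | B (w i)] =
    \bigcup_(s in B) [set w : Omega | w i = s].
  by apply: fin_bigcup_measurable => [|s _]; [exact: finite_finset|exact: h].
by apply/seteqP; split=> [w Bw|w [s Bs /= ->]//]; exists (w i).
Qed.

Let measurable_T : measurable_fun setT T.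
Proof.
apply: measurable_fun_if => //=.
- exact: measurable_fun_ltr.
- by apply: measurable_funTS; apply: measurable_funM => //;
  exact: measurable_funB.
Qed.

Let measurable_digits :
  @measurable_fun _ _ (measurableTypeR R) Omega setT digits.
Proof.
apply: (@measurability _ _ _ Omega _ _ coordinate_events) => //.
move=> _ [_ [i [s ->]] <-]; rewrite setTI.
have mi : measurable_fun setT (iter i T).
  elim: i => [|i IH]; first exact: measurable_id.
  by apply: measurableT_comp.
have : measurable_fun setT (fun u => iter i T u < p).
  exact: measurable_fun_ltr.
by move=> /(_ measurableT [set s] I); rewrite setTI.
Qed.

Let P : probability Omega R :=
  distribution (uniform_prob (@ltr01 R)) 
    (@mfun_Sub _ _ (measurableTypeR R) Omega _ (mem_set measurable_digits)).

Let digitsS u i : digits u i.+1 = digits (T u) i.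
Proof. by rewrite /digits iterSr. Qed.

(* The points of [0, 1[ with prescribed first n digits form an interval. *)
Let word_itv n (w : nat -> bool) : exists l : R,
  [/\ 0 <= l, l + \prod_(i < n) q (w i) <= 1 &
   forall u, 0 <= u < 1 -> (forall i, (i < n)%N -> digits u i = w i) <->
     l <= u < l + \prod_(i < n) q (w i)].
Proof.
have /andP[p0 p1] := p01.
elim: n w => [|n IH] w.
  by exists 0; rewrite big_ord0 add0r; split.
have [l [l0 l1 lP]] := IH (fun i => w i.+1).
rewrite big_ord_recl /=; under eq_bigr do rewrite /bump/= add1n.
move: l1 lP; set Q := \prod_(i < n) _ => l1 lP.
have Q0 : 0 <= Q.
  by apply: prodr_ge0 => i _; rewrite /q; case: ifP; rewrite ?subr_ge0.
have split_digits u : (forall i, (i < n.+1)%N -> digits u i = w i) <->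
    (digits u 0%N = w 0%N /\ forall i, (i < n)%N -> digits (T u) i = w i.+1).
  split=> [h|[h0 h] [|i] //].
    by split=> [|i ni]; [exact: h|rewrite -digitsS; exact: h].
  by rewrite ltnS digitsS => /h.
have scale (c v : R) : 0 < c -> c * (c^-1 * v) = v.
  by move=> c0; rewrite mulrA divff ?mul1r ?gt_eqF.
have pl := mulr_ge0 p0 l0.
have pQ := mulr_ge0 p0 Q0.
have pl1 : 0 <= p * (1 - (l + Q)) by apply: mulr_ge0; lra.
have p'l1 : 0 <= (1 - p) * (1 - (l + Q)) by apply: mulr_ge0; lra.
have p'l : 0 <= (1 - p) * l by apply: mulr_ge0; lra.
have p'Q : 0 <= (1 - p) * Q by apply: mulr_ge0; lra.
have scale_itv (c v : R) : 0 < c ->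
    (l <= c^-1 * v < l + Q) = (c * l <= v < c * l + c * Q).
  move=> c0; rewrite -[in RHS](scale c v c0) -mulrDr; move: (c^-1 * v) => u.
  by rewrite ler_pM2l// ltr_pM2l.
have unit_itv (c v : R) : 0 < c -> 0 <= v < c -> 0 <= c^-1 * v < 1.
  move=> c0 /andP[v0 vc]; rewrite mulr_ge0 ?invr_ge0 ?(ltW c0)//=.
  by rewrite mulrC ltr_pdivrMr// mul1r.
case: (w 0%N) split_digits => split_digits; rewrite [q _]/=.
  exists (p * l); split=> [//||u u01]; first lra.
  rewrite split_digits /digits/= /T; split=> [[up]|h].
    rewrite up => h; have p_gt0 : 0 < p by lra.
    rewrite -scale_itv//; apply/lP => //; apply: unit_itv => //; lra.
  have up : u < p by lra.
  have p_gt0 : 0 < p by lra.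
  rewrite up; split=> //; apply/lP; last by rewrite scale_itv.
  by apply: unit_itv => //; lra.
exists (p + (1 - p) * l); split=> [||u u01]; [lra|lra|].
rewrite split_digits /digits/= /T; split=> [[/negbT]|h].
  rewrite -leNgt => pu; rewrite ltNge pu/= => h.
  have p'_gt0 : 0 < 1 - p by lra.
  suff : (1 - p) * l <= u - p < (1 - p) * l + (1 - p) * Q by lra.
  by rewrite -scale_itv//; apply/lP => //; apply: unit_itv => //; lra.
have pu : p <= u by lra.
have p'_gt0 : 0 < 1 - p by lra.
rewrite ltNge pu/=; split=> //; apply/lP; last by rewrite scale_itv//; lra.
by apply: unit_itv => //; lra.
Qed.

Let P_word n (w : nat -> bool) :
  P [set o : Omega | forall i, (i < n)%N -> o i = w i] =
  (\prod_(i < n) q (w i))%:E.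
Proof.
have /andP[p0 p1] := p01.
have [l [l0 l1 lP]] := word_itv n w.
move: l1 lP; set Q := \prod_(i < n) _ => l1 lP.
have Q0 : 0 <= Q.
  by apply: prodr_ge0 => i _; rewrite /q; case: ifP; rewrite ?subr_ge0.
pose D := [set u | forall i, (i < n)%N -> digits u i = w i].
have mD : measurable D.
  have -> : D = \bigcap_(i in [set i | (i < n)%N])
      (digits @^-1` [set o : Omega | [set w i] (o i)]).
    by apply/seteqP; split=> u h i; exact: h.
  apply: bigcap_measurableType => i _.
  rewrite -[X in measurable X]setTI; apply: (measurable_digits measurableT).
  exact: (measurable_coordinate i [set w i]).
rewrite [LHS](_ : _ = uniform_prob (@ltr01 R) D)//.
rewrite /uniform_prob integral_uniform_pdf.
rewrite (eq_integral (fun=> 1%E)); last first.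
  move=> x; rewrite inE => -[_]; rewrite /= in_itv/= /uniform_pdf => ->.
  by rewrite subr0 invr1.
rewrite integral_cst ?mul1e; last exact: measurableI.
have -> : D `&` `[0, 1] = `[l, l + Q[ `|` (D `&` [set 1]).
  apply/seteqP; split=> [u [Du]|u].
    rewrite /= in_itv/= => /andP[u0]; rewrite le_eqVlt => /predU1P[u1|u1].
      by right; split.
    by left; rewrite /= in_itv/=; apply/lP => //; rewrite u0.
  case=> [|[Du u1]]; last first.
    by split=> //; rewrite (u1 : u = 1) /= in_itv/=; lra.
  rewrite /= in_itv/= => h; split; last by rewrite in_itv/=; lra.
  by apply/lP => //; lra.
rewrite measureU//; [|exact: measurableI|]; last first.
  by apply/seteqP; split=> // u [] /=; rewrite in_itv/= => h [_ u1]; lra.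
rewrite [X in (_ + X)%E](_ : _ = 0%E); last first.
  apply: (@subset_measure0 _ _ _ lebesgue_measure _ [set 1]) => //.
    exact: measurableI.
  exact: lebesgue_measure_set1.
rewrite adde0 [LHS](lebesgue_measure_itv `[l, l + Q[)/= lte_fin.
case: ifPn => h; first by rewrite -EFinD; congr EFin; ring.
by congr EFin; lra.
Qed.

Let qset (B : set bool) : R := \sum_(s | `[< B s >]) q s.

Let qsetE B : qset B = (if `[< B true >] then p else 0) +
                       (if `[< B false >] then 1 - p else 0).
Proof. by rewrite /qset big_mkcond big_bool. Qed.

Let P_rect n (B : nat -> set bool) :
  P [set o : Omega | forall i, (i < n)%N -> B i (o i)] =
  (\prod_(i < n) qset (B i))%:E.
Proof.
suff main k : (k <= n)%N -> forall B : nat -> set bool,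
    (forall i, (k <= i)%N -> exists s, B i = [set s]) ->
    P [set o : Omega | forall i, (i < n)%N -> B i (o i)] =
    (\prod_(i < n) qset (B i))%:E.
  pose B' i := if (i < n)%N then B i else [set true].
  transitivity (P [set o : Omega | forall i, (i < n)%N -> B' i (o i)]).
    congr (P _); apply/seteqP; split=> o h i ni; have := h i ni;
      by rewrite /B' ni.
  rewrite (main n)// => [|i].
    by congr EFin; apply: eq_bigr => i _; rewrite /B' ltn_ord.
  by rewrite leqNgt /B' => /negbTE ->; exists true.
elim: k => [_ {}B hB|k IH kn {}B hB].
  have [w wP] := choice (fun i => hB i (leq0n i)).
  transitivity (P [set o : Omega | forall i, (i < n)%N -> o i = w i]).
    congr (P _); apply/seteqP; split=> o h i ni; have := h i ni;
      by rewrite wP.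
  rewrite P_word; congr EFin; apply: eq_bigr => i _.
  rewrite /qset (big_pred1 (w i))// => s; rewrite wP/=.
  by apply/asboolP/eqP.
pose Bs s i := if i == k then [set s] `&` B k else B i.
have mB (C : nat -> set bool) :
    measurable [set o : Omega | forall i, (i < n)%N -> C i (o i)].
  rewrite [X in measurable X](_ : _ = \bigcap_(i in [set i | (i < n)%N])
      [set o : Omega | C i (o i)])//.
  by apply: bigcap_measurableType => i _; exact: measurable_coordinate.
have PBs s : P [set o : Omega | forall i, (i < n)%N -> Bs s i (o i)] =
    (\prod_(i < n) qset (Bs s i))%:E.
  have [Bks|nBks] := pselect (B k s).
    apply: IH => [|i ki]; first exact: ltnW.
    rewrite /Bs; case: eqP => [_|/eqP ik].
      exists s; apply/seteqP; split=> [t []//|t /= ->].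
      by split.
    by apply: hB; rewrite ltn_neqAle eq_sym ik.
  rewrite [X in P X](_ : _ = set0) ?measure0.
    rewrite (bigD1 (Ordinal kn))//= [qset _]big1 ?mul0r// => t.
    by move=> /asboolP; rewrite /Bs eqxx => -[->].
  by apply/seteqP; split=> // o /(_ _ kn); rewrite /Bs eqxx => -[/= ->] /nBks.
transitivity (P [set o : Omega | forall i, (i < n)%N -> Bs true i (o i)] +
              P [set o : Omega | forall i, (i < n)%N -> Bs false i (o i)])%E.
  rewrite -measureU//.
    congr (P _); apply/seteqP; split=> o.
      move=> h; case e : (o k); [left|right] => i ni; rewrite /Bs;
        by case: eqP => [->|_]; [split=> //; exact: h|exact: h].
    by case=> h i ni; have := h i ni; rewrite /Bs; case: eqP => [-> []|].
  apply/seteqP; split=> // o [/(_ _ kn) + /(_ _ kn)].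
  by rewrite /Bs eqxx => -[/= -> _] [].
rewrite !PBs -EFinD; congr EFin.
have prodk (C : nat -> set bool) : \prod_(i < n) qset (C i) =
    qset (C k) * \prod_(i < n | i != Ordinal kn) qset (C i).
  by rewrite (bigD1 (Ordinal kn)).
rewrite !prodk.
have e s : \prod_(i < n | i != Ordinal kn) qset (Bs s i) =
    \prod_(i < n | i != Ordinal kn) qset (B i).
  by apply: eq_bigr => i ik; rewrite /Bs ifN.
rewrite !e -mulrDl; congr (_ * _).
rewrite /Bs eqxx !qsetE.
have -> : `[< ([set true] `&` B k) true >] = `[< B k true >].
  by apply: asbool_equiv_eq; split=> [[]|].
have -> : `[< ([set true] `&` B k) false >] = false.
  by apply/asboolP => -[].
have -> : `[< ([set false] `&` B k) true >] = false.
  by apply/asboolP => -[].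
have -> : `[< ([set false] `&` B k) false >] = `[< B k false >].
  by apply: asbool_equiv_eq; split=> [[]|].
by rewrite addr0 add0r.
Qed.

Let P_fset (J : {fset nat}) (B : nat -> set bool) :
  P [set o : Omega | forall i, i \in J -> B i (o i)] =
  (\prod_(i <- J) qset (B i))%:E.
Proof.
pose n := (\max_(i <- J) i).+1.
have Jn i : i \in J -> (i < n)%N by move=> iJ; rewrite ltnS leq_bigmax_seq.
have qT : qset setT = 1.
  by rewrite qsetE !asboolT// addrC subrK.
pose B' i := if i \in J then B i else setT.
transitivity (P [set o : Omega | forall i, (i < n)%N -> B' i (o i)]).
  congr (P _); apply/seteqP; split=> o h i.
    by move=> _; rewrite /B'; case: ifPn => // /h.
  by move=> iJ; have := h i (Jn _ iJ); rewrite /B' iJ.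
rewrite P_rect; congr EFin.
rewrite (eq_bigr (fun i : 'I_n => if (i : nat) \in J then qset (B i) else 1)).
  rewrite -big_mkcond/= -(big_mkord (fun i => i \in J) (fun i => qset (B i))).
  rewrite -big_filter; apply: perm_big; apply: uniq_perm => [||i].
  - exact/filter_uniq/iota_uniq.
  - exact: fset_uniq.
  - rewrite mem_filter mem_index_iota leq0n/=.
    by case: (boolP (i \in J)) => // /Jn.
by move=> i _; rewrite /B'; case: ifP.
Qed.

Lemma bernoulli_product_exists : exists Q, is_bernoulli_product p Q.
Proof.
have P1 i B : P [set o : Omega | B (o i)] = (qset B)%:E.
  rewrite -[RHS](_ : (\prod_(i <- [fset i]%fset) qset B)%:E = _).
    rewrite -(P_fset _ (fun=> B)); congr (P _).
    apply/seteqP; split=> o /= h; last by apply: h; rewrite inE.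
    by move=> j; rewrite inE => /eqP ->.
  by rewrite big_seq_fset1.
exists P; split=> [J B|i].
  by rewrite P_fset -prodEFin; apply: eq_bigr => i _; rewrite P1.
have q1 s : qset [set s] = q s.
  by rewrite /qset (big_pred1 s)// => t; apply/asboolP/eqP.
by split; [rewrite (P1 i [set true])|rewrite (P1 i [set false])]; rewrite q1.
Qed.

End Existence.

(* Main.v *)
(* The pair (x_n, y_n) is a Markov chain, and up to a probability tending to 0
   it lives in the finite set S = (A U {x, y})^2. Hence the matrices Q_n of
   n-step transition probabilities between points of S satisfy
   0 <= Q_(n+m) - Q_n Q_m <= e_n with e_n -> 0. Let C and D be limits of the
   Cesaro means of Q_n along two ultrafilters. Averaging in n gives C = C Q_m
   for all m, while averaging in m gives Q_n C -> C; averaging once more yields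
   C = C D and C = D C. Exchanging C and D gives C = D C = D, so the means
   converge. Therefore F_xy^(n)(t) converges for every t, F*_xy = F_xy, and the
   integral vanishes. *)
Require Import Defs.
From mathcomp Require Import all_boot all_order all_algebra finmap.
From mathcomp Require Import all_classical all_reals all_analysis.
From mathcomp Require Import ring lra.

Import Order.TTheory GRing.Theory Num.Theory.
Import numFieldNormedType.Exports.

Local Open Scope classical_set_scope.
Local Open Scope ring_scope.

Lemma eq_cvgW (T : Type) (U : nbhsType) (F : set_system T) (f g : T -> U)
    (l : set_system U) :
  f =1 g -> f @ F --> l -> g @ F --> l.
Proof. by move=> /funext ->. Qed.

Lemma indic01 (R : realType) (T : Type) (B : set T) x : 0 <= (\1_B x : R) <= 1.
Proof. by rewrite indicE; case: (_ \in _); rewrite /= ?lexx ler01. Qed.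

(** * Cesaro means, and a mean ergodic theorem for almost multiplicative families of finite
    matrices *)

Section MeanErgodic.
Context {R : realType}.
Implicit Types u v : R^nat.

Lemma arithmetic_meanE u n :
  arithmetic_mean u n = n.+1%:R^-1 * \sum_(0 <= k < n.+1) u k.
Proof. by rewrite /arithmetic_mean/= seriesEnat. Qed.

Lemma arithmetic_meanB u v :
  arithmetic_mean (fun n => u n - v n) =
  (fun n => arithmetic_mean u n - arithmetic_mean v n).
Proof.
by apply/funext => n; rewrite !arithmetic_meanE big_split/= sumrN mulrBr.
Qed.

Lemma arithmetic_mean_sum (I : finType) (c : I -> R) (u : I -> R^nat) :
  arithmetic_mean (fun n => \sum_i u i n * c i) =
  (fun n => \sum_i arithmetic_mean (u i) n * c i).
Proof.
apply/funext => n; rewrite arithmetic_meanE exchange_big/= mulr_sumr.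
by apply: eq_bigr => i _; rewrite arithmetic_meanE -mulr_suml mulrA.
Qed.

Lemma arithmetic_mean_itv u (c d : R) n :
  (forall k, c <= u k <= d) -> c <= arithmetic_mean u n <= d.
Proof.
move=> ucd; rewrite arithmetic_meanE mulrC ler_pdivlMr ?ler_pdivrMr ?ltr0n//.
have cst (x : R) : x *+ n.+1 = \sum_(0 <= k < n.+1) x.
  by rewrite sumr_const_nat subn0.
rewrite !mulr_natr !cst.
by apply/andP; split; apply: ler_sum => k _; case/andP: (ucd k).
Qed.

(** A shift by one telescopes: the two means differ by [(u n.+1 - u 0) / n.+1], at most [1 / n.+1]
    in absolute value. A shift by [m] is a chain of such steps. *)
Lemma arithmetic_mean_shift u m : (forall n, 0 <= u n <= 1) ->
  arithmetic_mean (fun n => u (m + n)%N) n - arithmetic_mean u n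
    @[n --> \oo] --> 0.
Proof.
elim: m u => [|m IH] u u01.
  under eq_cvg do rewrite subrr.
  exact: cvg_cst.
have h : arithmetic_mean (fun n => u n.+1) n - arithmetic_mean u n
    @[n --> \oo] --> 0.
  apply: norm_cvg0.
  apply: (@squeeze_cvgr _ _ _ R (fun=> 0) (@harmonic R));
    [|exact: cvg_cst|exact: cvg_harmonic].
  near=> n; rewrite normr_ge0/= !arithmetic_meanE -mulrBr.
  rewrite big_nat_recr//= [X in _ - X]big_nat_recl//= opprD addrACA.
  rewrite normrM ger0_norm ?invr_ge0// ger_pMr ?invr_gt0 ?ltr0n// ler_norml.
  have := u01 0%N; have := u01 n.+1; move: (\sum_(_ <= _ < _) _) => s; lra.
have /(_ _) := cvgD (IH (fun n => u n.+1) (fun n => u01 n.+1)) h.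
rewrite addr0; apply: eq_cvgW => n /=.
by rewrite !fctE addrA subrK.
Unshelve. all: by end_near. Qed.

(** By compactness the image ultrafilter has a cluster point in [0, 1], and an ultrafilter converges
    to each of its cluster points. *)
Lemma unit_ultra_cvg (T : Type) (U : set_system T) (c : T -> R) :
  UltraFilter U -> (forall t, 0 <= c t <= 1) ->
  exists l : R, c t @[t --> U] --> l.
Proof.
move=> UU c01; have [|l [_ cl]] := @segment_compact R 0 1 (c @ U) _.
  by apply: (@filterS _ U _ setT) => [t _|];
    [rewrite /= in_itv/=|exact: filterT].
exists l => B nB; have [//|UB] := in_ultra_setVsetC (c @^-1` B) UU.
by have [z [nBz Bz]] : ~` B `&` B !=set0 by exact: cl.
Qed.

Lemma cvg_sumr (T : Type) (F : set_system T) (I : finType)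
    (u : I -> T -> R) (l : I -> R) :
  Filter F -> (forall i, u i t @[t --> F] --> l i) ->
  (\sum_i u i t) @[t --> F] --> \sum_i l i.
Proof.
move=> FF ul; apply: cvg_big => [|i _]; last exact: ul.
exact: add_continuous.
Qed.

(** Meant for [q n], the n-step transition probabilities of a chain between states of a finite set,
    and [e n i], the probability that the chain started at [i] is outside this set at time [n]. The
    defect between [q (n + m)] and the product of [q n] and [q m] counts the paths that are outside
    at time [n]. *)
Lemma mean_ergodic (I : finType) (q : nat -> I -> I -> R) (e : nat -> I -> R) :
  (forall n i j, 0 <= q n i j <= 1) ->
  (forall n m i j,
     0 <= q (n + m)%N i j - \sum_k q n i k * q m k j <= e n i) ->
  (forall i, e n i @[n --> \oo] --> 0) ->
  forall i j, cvgn (arithmetic_mean (fun n => q n i j)).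
Proof.
move=> q01 qe e0.
pose c n i j := arithmetic_mean (fun n => q n i j) n.
have c01 n i j : 0 <= c n i j <= 1 by apply: arithmetic_mean_itv.
have lim_ultra (U : set_system nat) : UltraFilter U ->
    exists C : I -> I -> R, forall i j, c n i j @[n --> U] --> C i j.
  move=> UU; have h i j := unit_ultra_cvg _ _ _ UU (fun n => c01 n i j).
  exists (fun i j => projT1 (cid (h i j))) => i j; exact: projT2 (cid (h i j)).
(* C Q_m = C: with [m] fixed the defect vanishes as [n] grows, hence so does its mean, and a shift
   by [m] does not affect the limit of the means. *)
have right U (C : I -> I -> R) m : UltraFilter U -> \oo `<=` U ->
    (forall i j, c n i j @[n --> U] --> C i j) ->
    forall i j, \sum_k C i k * q m k j = C i j.
  move=> UU oU cC i j; apply/eqP; rewrite eq_sym -subr_eq0; apply/eqP.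
  have lhs : c n i j - \sum_k c n i k * q m k j @[n --> U] -->
      C i j - \sum_k C i k * q m k j.
    apply: cvgB => //; apply: cvg_sumr => k; apply: cvgM => //; exact: cvg_cst.
  apply: (cvg_unique _ lhs) => //.
  suff : c n i j - \sum_k c n i k * q m k j @[n --> \oo] --> 0.
    by apply: cvg_trans; exact: cvg_app.
  have d0 : q (n + m)%N i j - \sum_k q n i k * q m k j @[n --> \oo] --> 0.
    apply: (squeeze_cvgr _ (cvg_cst 0) (e0 i)).
    by apply: nearW => n; exact: qe.
  have /(_ _) := cvgB (cesaro d0)
    (arithmetic_mean_shift _ m (fun n => q01 n i j)).
  rewrite subr0; apply: eq_cvgW => n.
  rewrite arithmetic_meanB arithmetic_mean_sum/=.
  rewrite (_ : (fun n => q (n + m)%N i j) = (fun n => q (m + n)%N i j)).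
    by rewrite !fctE /c; ring.
  by apply/funext => k; rewrite addnC.
(* Q_n C -> C: here [n] is fixed while [m] is averaged, so the defect only stays within [0,
   [e n i]]; [n] grows afterwards. *)
have left U (C : I -> I -> R) : UltraFilter U -> \oo `<=` U ->
    (forall i j, c n i j @[n --> U] --> C i j) ->
    forall i j, \sum_k q n i k * C k j @[n --> \oo] --> C i j.
  move=> UU oU cC i j.
  suff h n : 0 <= C i j - \sum_k q n i k * C k j <= e n i.
    have : C i j - \sum_k q n i k * C k j @[n --> \oo] --> 0.
      apply: (squeeze_cvgr _ (cvg_cst 0) (e0 i)).
      by apply: nearW => n; exact: h.
    move=> /(cvgB (cvg_cst (C i j))); rewrite subr0.
    by apply: eq_cvgW => n; rewrite !fctE; ring.
  have lhs : c N i j - \sum_k c N k j * q n i k @[N --> U] -->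
      C i j - \sum_k C k j * q n i k.
    apply: cvgB => //; apply: cvg_sumr => k; apply: cvgM => //; exact: cvg_cst.
  have shift := cvg_trans (cvg_app _ oU)
    (arithmetic_mean_shift _ n (fun n => q01 n i j)).
  have /(_ _) := cvgD lhs shift; rewrite addr0.
  have -> : \sum_k q n i k * C k j = \sum_k C k j * q n i k.
    by apply: eq_bigr => k _; rewrite mulrC.
  move=> dC.
  (* Regrouped, this is the mean over [m] of the defects, each of which lies in [0, [e n i]]. *)
  have d N : 0 <= c N i j - \sum_k c N k j * q n i k +
      (arithmetic_mean (fun m => q (n + m)%N i j) N - c N i j) <= e n i.
    have -> : c N i j - \sum_k c N k j * q n i k +
      (arithmetic_mean (fun m => q (n + m)%N i j) N - c N i j) =
      arithmetic_mean (fun m => q (n + m)%N i j - \sum_k q m k j * q n i k) N.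
      by rewrite arithmetic_meanB arithmetic_mean_sum/= /c; ring.
    apply: arithmetic_mean_itv => m.
    by under eq_bigr do rewrite mulrC; exact: qe.
  have itvcl := @interval_closed R (BLeft 0) (BRight (e n i)) isT isT.
  have : `[0, e n i]%classic (C i j - \sum_k C k j * q n i k).
    apply: (closed_cvg _ itvcl _ _ dC).
    by apply: nearW => N; rewrite /= in_itv/=; exact: d.
  by rewrite /= in_itv.
(* C = C D: average C Q_m = C over [m] and pass to the limit along [V]. *)
have prodr U V (C D : I -> I -> R) :
    UltraFilter U -> UltraFilter V -> \oo `<=` U -> \oo `<=` V ->
    (forall i j, c n i j @[n --> U] --> C i j) ->
    (forall i j, c n i j @[n --> V] --> D i j) ->
    forall i j, C i j = \sum_k C i k * D k j.
  move=> UU VV oU oV cC cD i j.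
  have DV : \sum_k c n k j * C i k @[n --> V] --> \sum_k D k j * C i k.
    apply: cvg_sumr => k; apply: cvgM => //; exact: cvg_cst.
  under eq_bigr do rewrite mulrC.
  apply: (cvg_unique _ _ DV) => //.
  suff : \sum_k c n k j * C i k @[n --> \oo] --> C i j.
    by apply: cvg_trans; exact: cvg_app.
  rewrite /c -arithmetic_mean_sum; apply: cesaro.
  apply: cvg_near_cst; apply: nearW => m.
  by rewrite -(right U C m UU oU cC i j); apply: eq_bigr => k _; rewrite mulrC.
(* C = D C: average Q_n C -> C over [n] and pass to the limit along [V]. *)
have prodl U V (C D : I -> I -> R) :
    UltraFilter U -> UltraFilter V -> \oo `<=` U -> \oo `<=` V ->
    (forall i j, c n i j @[n --> U] --> C i j) ->
    (forall i j, c n i j @[n --> V] --> D i j) ->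
    forall i j, C i j = \sum_k D i k * C k j.
  move=> UU VV oU oV cC cD i j.
  have DV : \sum_k c n i k * C k j @[n --> V] --> \sum_k D i k * C k j.
    apply: cvg_sumr => k; apply: cvgM => //; exact: cvg_cst.
  apply: (cvg_unique _ _ DV) => //.
  suff : \sum_k c n i k * C k j @[n --> \oo] --> C i j.
    by apply: cvg_trans; exact: cvg_app.
  rewrite /c -arithmetic_mean_sum; apply: cesaro.
  exact: left oU cC i j.
move=> i j.
have [U [UU oU]] := ultraFilterLemma (@eventually_filter).
have [C cC] := lim_ultra U UU.
apply/cvg_ex; exists (C i j) => B nB.
apply: contrapT => nnB.
(* The means avoid the neighbourhood [B] at arbitrarily large indices, so [\oo] restricted to these
   indices is a proper filter. An ultrafilter [V] refining it yields a second limit [D]. *)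
pose W := within (~` [set n | B (c n i j)]) \oo.
have WP : ProperFilter W.
  apply: Build_ProperFilter => wS.
  by apply: nnB; apply: filterS (wS : \oo _) => n /= h; apply: contrapT => /h.
have [V [VV WV]] := ultraFilterLemma WP.
have oV : \oo `<=` V.
  by move=> S oS; apply: WV; apply: filterS oS => n Sn _.
have [D cD] := lim_ultra V VV.
(* Both sides are the same entry of the product D C. *)
have CD : C i j = D i j.
  by rewrite (prodl U V C D)// -(prodr V U D C).
have BV : V [set n | B (c n i j)] by apply: (cD i j); rewrite -CD.
have nBV : V (~` [set n | B (c n i j)]) by apply: WV; exact: nearW.
apply: (filter_not_empty V); rewrite -(setICr [set n | B (c n i j)]).
exact: filterI.
Qed.

End MeanErgodic.

(** * Transition operator of the chain that applies [F] with probability [p] and [G] otherwise *)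

Section TransferOperator.
Context {R : realType} {Z : choiceType} (F G : Z -> Z) (p : R).
Implicit Types (phi psi : Z -> R) (z : Z).

Definition transfer phi z := p * phi (F z) + (1 - p) * phi (G z).

(** The expected value of [phi] at time [n], as a function of the starting point. Being an iterate,
    it is handled by pure algebra; [prob_random_orbit] ties it to [P]. *)
Definition expect n phi := iter n transfer phi.

Lemma expectD n m phi : expect (n + m) phi = expect n (expect m phi).
Proof. exact: iterD. Qed.

Lemma expectB n phi psi z :
  expect n (fun y => phi y - psi y) z = expect n phi z - expect n psi z.
Proof.
by elim: n z => //= n IH z; rewrite /transfer !IH; ring.
Qed.

Lemma expect_sum (I : finType) (c : I -> R) (phi : I -> Z -> R) n z :
  expect n (fun y => \sum_i phi i y * c i) z = \sum_i expect n (phi i) z * c i.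
Proof.
elim: n z => //= n IH z; rewrite /transfer !IH !mulr_sumr -big_split/=.
by apply: eq_bigr => i _; ring.
Qed.

Lemma le_expect n phi psi z : 0 <= p <= 1 -> (forall y, phi y <= psi y) ->
  expect n phi z <= expect n psi z.
Proof.
move=> /andP[p0 p1] le_phi; elim: n z => //= n IH z.
by rewrite lerD// ler_wpM2l// subr_ge0.
Qed.

Lemma expect_cst n (c : R) z : expect n (fun=> c) z = c.
Proof. by elim: n z => //= n IH z; rewrite /transfer !IH; ring. Qed.

Lemma expect01 n phi z : 0 <= p <= 1 -> (forall y, 0 <= phi y <= 1) ->
  0 <= expect n phi z <= 1.
Proof.
move=> p01 phi01; apply/andP; split;
  [rewrite -(expect_cst n 0 z)|rewrite -(expect_cst n 1 z)];
  by apply: le_expect => // y; case/andP: (phi01 y).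
Qed.

(** The sum is the contribution of the paths that are in [S] at time [n]. What remains is the
    expectation of [phi] restricted to the complement of [S], and [phi] takes values in [0, 1]. *)
Lemma expect_fset (S : {fset Z}) n phi z : 0 <= p <= 1 ->
  (forall y, 0 <= phi y <= 1) ->
  0 <= expect n phi z - \sum_(k : S) expect n \1_[set val k] z * phi (val k)
    <= expect n \1_(~` [set` S]) z.
Proof.
move=> p01 phi01; rewrite -expect_sum -expectB.
rewrite -[X in X <= _ <= _](expect_cst n 0 z).
have E y : phi y - \sum_(k : S) \1_[set val k] y * phi (val k) =
    phi y * (y \notin S)%:R.
  have [yS|yS] := boolP (y \in S); last first.
    rewrite big1 ?subr0 ?mulr1// => k _.
    rewrite indicE memNset ?mul0r// => /= yk.
    by move: yS; rewrite yk (valP k).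
  rewrite (bigD1 [` yS]%fset)//= big1 ?addr0 => [|k ky].
    by rewrite indicE mem_set// mul1r subrr mulr0.
  rewrite indicE memNset ?mul0r// => /= yk.
  by move/eqP: ky; apply; apply/val_inj.
apply/andP; split; apply: le_expect => // y; rewrite E.
  by case/andP: (phi01 y) => *; rewrite mulr_ge0.
rewrite indicE; have [yS|yS] := boolP (y \in S); first by rewrite mulr0.
by rewrite mulr1 mem_set ?(andP (phi01 y)).2// => /= yS'; move: yS; rewrite yS'.
Qed.

(** The recursion of [expect] conditions on the first step. This form conditions on the last one,
    which is the step that the recursion of [random_orbit] peels off. *)
Lemma expect_indicS n (B : set Z) z : expect n.+1 \1_B z =
  p * expect n \1_(F @^-1` B) z + (1 - p) * expect n \1_(G @^-1` B) z.
Proof.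
rewrite /expect iterSr.
elim: n z => //= n IH z.
by rewrite {1}/transfer !IH /transfer; ring.
Qed.

End TransferOperator.

(** * Law of the random orbit under the Bernoulli measure *)

Section RandomOrbit.
Context {R : realType} {Z : choiceType} (F G : Z -> Z) (p : R).
Context (P : probability Omega R) (HP : is_bernoulli_product p P).

Fixpoint random_orbit (w : Omega) (z : Z) n : Z :=
  if n is m.+1 then (if w m then F else G) (random_orbit w z m) else z.

Lemma measurable_coordinate i (B : set bool) :
  measurable [set w : Omega | B (w i)].
Proof.
have h s : measurable [set w : Omega | w i = s].
  by apply: sub_sigma_algebra; exists i, s.
rewrite (_ : [set w : Omega | B (w i)] =
    \bigcup_(s in B) [set w : Omega | w i = s]).
  by apply: fin_bigcup_measurable => [|s _]; [exact: finite_finset|exact: h].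
by apply/seteqP; split=> [w Bw|w [s Bs /= ->]//]; exists (w i).
Qed.

Let rect (J : {fset nat}) (C : nat -> set bool) : set Omega :=
  [set w | forall i, i \in J -> C i (w i)].

Let measurable_rect J C : measurable (rect J C).
Proof.
rewrite (_ : rect J C = \bigcap_(i in [set` J]) [set w : Omega | C i (w i)])//.
by apply: bigcap_measurableType => i _; exact: measurable_coordinate.
Qed.

Lemma random_orbitS n (B : set Z) z :
  [set w : Omega | B (random_orbit w z n.+1)] =
  ([set w | (F @^-1` B) (random_orbit w z n)] `&` [set w | w n = true]) `|`
  ([set w | (G @^-1` B) (random_orbit w z n)] `&` [set w | w n = false]).
Proof.
apply/seteqP; split=> w /=; first by case: (w n) => ?; [left|right].
by case=> -[+ ->].
Qed.

Lemma measurable_random_orbit n (B : set Z) z :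
  measurable [set w : Omega | B (random_orbit w z n)].
Proof.
elim: n B => [|n IH] B.
  have [Bz|nBz] := pselect (B z).
    by rewrite (_ : [set w | _] = setT)//; apply/seteqP; split.
  by rewrite (_ : [set w | _] = set0)//; apply/seteqP; split.
rewrite random_orbitS; apply: measurableU; apply: measurableI => //.
- exact: (measurable_coordinate n [set true]).
- exact: (measurable_coordinate n [set false]).
Qed.

Let cyl n (s : bool) (C : nat -> set bool) i := if i == n then [set s] else C i.

Let prob_rect_cyl n s (J : {fset nat}) C : n \notin J ->
  P (rect (n |` J)%fset (cyl n s C)) =
  ((if s then p else 1 - p)%:E * P (rect J C))%E.
Proof.
have [indep marg] := HP => nJ.
rewrite /rect !indep big_fsetU1//=; congr (_ * _)%E.
  by rewrite /cyl eqxx /=; case: s; [exact: (marg n).1|exact: (marg n).2].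
apply: eq_big_seq => i iJ; rewrite /cyl ifN//.
by apply: contraNneq nJ => <-.
Qed.

(* The rectangle in coordinates [>= n] is what makes the induction on [n] go
   through: the last step of the orbit becomes one more such coordinate. *)
Let prob_orbit_rect n (B : set Z) z (J : {fset nat}) C :
  (forall j, j \in J -> (n <= j)%N) ->
  P ([set w | B (random_orbit w z n)] `&` rect J C) =
  ((expect F G p n \1_B z)%:E * P (rect J C))%E.
Proof.
elim: n B J C => [|n IH] B J C nJ.
  rewrite /= indicE; have [Bz|nBz] := pselect (B z).
    rewrite mem_set// mul1e; congr (P _).
    by apply/seteqP; split=> [w []//|w wJ]; split.
  rewrite memNset// mul0e (_ : _ `&` _ = set0) ?measure0//.
  by apply/seteqP; split=> [w []//|w].
have n_notin : n \notin J by apply/negP => /nJ; rewrite ltnn.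
have nJ' j : j \in (n |` J)%fset -> (n <= j)%N.
  by rewrite !inE => /predU1P[->//|/nJ/ltnW].
(* The symbol of the last step joins the rectangle as a new coordinate, since [n] lies outside
   [J]. *)
have rectU s : [set w : Omega | w n = s] `&` rect J C =
    rect (n |` J)%fset (cyl n s C).
  apply/seteqP; split=> w.
    move=> [ws wC] i; rewrite /cyl !inE; case: eqP => [->//|_ /= iJ].
    exact: wC.
  move=> wC; split=> [|i iJ].
    by have := wC n; rewrite !inE eqxx /cyl eqxx; apply.
  have := wC i; rewrite !inE iJ orbT /cyl ifN; first exact.
  by apply: contraNneq n_notin => <-.
rewrite random_orbitS setIUl -!setIA !rectU.
transitivity (P ([set w | (F @^-1` B) (random_orbit w z n)] `&`
      rect (n |` J)%fset (cyl n true C)) +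
    P ([set w | (G @^-1` B) (random_orbit w z n)] `&`
      rect (n |` J)%fset (cyl n false C)))%E.
  rewrite measureU//; first last.
  - apply/seteqP; split=> // w [[_ w1] [_ w0]].
    have := w1 n; have := w0 n; rewrite !inE eqxx /cyl eqxx /=.
    by move=> /(_ isT) -> /(_ isT).
  - apply: measurableI; last exact: measurable_rect.
    exact: measurable_random_orbit.
  - apply: measurableI; last exact: measurable_rect.
    exact: measurable_random_orbit.
rewrite !IH// !prob_rect_cyl// expect_indicS !muleA -!EFinM.
rewrite -muleDl//; last exact: fin_num_measure.
by rewrite -EFinD; congr (_%:E * _)%E; ring.
Qed.

Lemma prob_random_orbit n (B : set Z) z :
  P [set w | B (random_orbit w z n)] = (expect F G p n \1_B z)%:E.
Proof.
(* With no coordinate constrained, the rectangle is the whole space. *)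
have := @prob_orbit_rect n B z fset0 (fun=> setT).
rewrite (_ : rect _ _ = setT); last by apply/seteqP; split.
by rewrite setIT probability_setT mule1; apply.
Qed.

End RandomOrbit.

(** * Convergence of Cesaro means when the chain concentrates on a finite set, applied to pairs of
    trajectories *)

Lemma is_cvg_mean_expect (R : realType) (Z : choiceType) (F G : Z -> Z) (p : R)
    (S : {fset Z}) (phi : Z -> R) :
  0 <= p <= 1 -> (forall y, 0 <= phi y <= 1) ->
  (forall z, z \in S -> expect F G p n \1_(~` [set` S]) z @[n --> \oo] --> 0) ->
  forall z, z \in S -> cvgn (arithmetic_mean (fun n => expect F G p n phi z)).
Proof.
move=> p01 phi01 leak z zS.
pose q n (i j : S) := expect F G p n \1_[set val j] (val i).
have qcvg (i j : S) : cvgn (arithmetic_mean (fun n => q n i j)).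
  apply: (@mean_ergodic R S q
      (fun n i => expect F G p n \1_(~` [set` S]) (val i))) =>
    [n k l|n m k l|k].
  - apply: expect01 => //; exact: indic01.
  - rewrite /q expectD; apply: expect_fset => // y.
    apply: expect01 => //; exact: indic01.
  - exact/leak/valP.
pose s : S := [` zS]%fset.
(* The part of the expectation carried by [S] is a finite combination of entries of [q], whose means
   converge. The remainder [r] is at most the probability of being outside [S]. *)
pose r n := expect F G p n phi z - \sum_k q n s k * phi (val k).
have r0 : r n @[n --> \oo] --> 0.
  apply: (squeeze_cvgr _ (cvg_cst 0) (leak z zS)); apply: nearW => n.
  exact: expect_fset.
have qsum : cvgn (arithmetic_mean (fun n => \sum_k q n s k * phi (val k))).
  rewrite (arithmetic_mean_sum S (fun k => phi (val k)) (fun k n => q n s k)).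
  apply/cvg_ex; eexists; apply: cvg_sumr => k.
  by apply: cvgM; [exact: qcvg|exact: cvg_cst].
apply/cvg_ex; eexists.
have /(_ _) := cvgD (cesaro r0) qsum; apply: eq_cvgW => n.
by rewrite /r arithmetic_meanB !fctE subrK.
Qed.

(** One sequence of symbols drives both trajectories, so the pair is a single orbit under the
    product maps. *)
Lemma random_orbit_pair (R : realType) (f g : R -> R) w x y n :
  random_orbit (fun z : R * R => (f z.1, f z.2))
    (fun z : R * R => (g z.1, g z.2)) w (x, y) n =
  (trajectory f g w x n, trajectory f g w y n).
Proof. by elim: n => //= n ->; case: (w n). Qed.

Lemma cvg_Fn (R : realType) (a b : R) (f g : R -> R) (p : R)
    (P : probability Omega R) (A : set R) (x y t : R) :
  0 <= p <= 1 ->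
  is_bernoulli_product p P ->
  finite_set A ->
  A `<=` `[a, b] ->
  (forall u, u \in `[a, b] ->
     P [set w : Omega | A (trajectory f g w u n)] @[n --> \oo] --> 1%E) ->
  x \in `[a, b] -> y \in `[a, b] ->
  exists l : R, Fn f g P x y n t @[n --> \oo] --> l%:E.
Proof.
move=> p01 HP finA Aab PA xab yab.
pose F (z : R * R) := (f z.1, f z.2); pose G (z : R * R) := (g z.1, g z.2).
(* Adding [x] and [y] puts the starting pair into the product of [A'] with itself, while all
   coordinates stay in [a, b], where [PA] applies. *)
pose A' := A `|` [set x; y].
have A'ab u : A' u -> u \in `[a, b] by case=> [/Aab//|[] ->].
have /finite_fsetP[S ES] : finite_set (A' `*` A').
  by apply: finite_setX; rewrite finite_setU; split.
have probE n (B : set (R * R)) z :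
    P [set w | B (trajectory f g w z.1 n, trajectory f g w z.2 n)] =
    (expect F G p n \1_B z)%:E.
  rewrite -(prob_random_orbit F G p P HP); congr (P _).
  by apply/funext => w; rewrite /mkset; case: z => u v;
    rewrite random_orbit_pair.
have coord z (pr : R * R -> R) (u := pr z) :
    (forall w n, pr (trajectory f g w z.1 n, trajectory f g w z.2 n) =
       trajectory f g w u n) -> u \in `[a, b] ->
    expect F G p n \1_(pr @^-1` A) z @[n --> \oo] --> (1 : R).
  move=> prE uab; have := PA u uab.
  rewrite (_ : (fun n => P _) =
      EFin \o (fun n => expect F G p n \1_(pr @^-1` A) z)).
    by move=> /fine_cvg.
  apply/funext => n; rewrite /= -probE; congr (P _).
  by apply/funext => w; rewrite /mkset /preimage /mkset prE.
have leak z : z \in S -> expect F G p n \1_(~` [set` S]) z @[n --> \oo] --> 0.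
  move=> zS; have [z1 z2] : (A' `*` A') z by rewrite ES.
  have c1 := coord z fst (fun _ _ => erefl) (A'ab _ z1).
  have c2 := coord z snd (fun _ _ => erefl) (A'ab _ z2).
  (* Union bound: outside [S] at least one coordinate misses [A], and each of these two events has
     probability tending to 0. Both terms are written as differences with the constant 1 so that
     [expectB] applies. *)
  have c12 : (1 - expect F G p n \1_(fst @^-1` A) z) -
      (expect F G p n \1_(snd @^-1` A) z - 1) @[n --> \oo] --> (0 : R).
    rewrite -(subrr (1 - 1 : R)).
    by apply: cvgB; apply: cvgB => //; exact: cvg_cst.
  apply: (squeeze_cvgr _ (cvg_cst 0) c12); apply: nearW => n.
  have [/= -> _] := andP (expect01 F G p n _ z p01
    (indic01 R _ (~` [set` S]))).
  rewrite -{1}(expect_cst F G p n 1 z) -{2}(expect_cst F G p n 1 z) -!expectB.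
  apply: le_expect => // v; rewrite -ES !indicE.
  case: (pselect (A v.1)) => [v1|v1]; last first.
    rewrite [v \in fst @^-1` _]memNset// subr0.
    case: (_ \in _); case: (_ \in _) => /=; lra.
  case: (pselect (A v.2)) => [v2|v2]; last first.
    rewrite [v \in snd @^-1` _]memNset//.
    case: (_ \in _); case: (_ \in _) => /=; lra.
  rewrite memNset ?mem_set// ?subrr// => -[].
  by split; left.
pose D := [set z : R * R | `|z.1 - z.2| < t].
have zS : (x, y) \in S.
  have : (A' `*` A') (x, y) by split; right; [left|right].
  by rewrite ES.
have /cvg_ex[l cl] := is_cvg_mean_expect R _ F G p S \1_D p01 (indic01 R _ D)
  leak _ zS.
(* [Fn] at [n.+1] averages [n.+1] terms, as does [arithmetic_mean] at [n]; the default value of [Fn]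
   at 0 is dropped. *)
exists l; rewrite -cvg_shiftS.
have FnE n : Fn f g P x y n.+1 t =
    (arithmetic_mean (fun n => expect F G p n \1_D (x, y)) n)%:E.
  rewrite /Fn arithmetic_meanE EFinM -sumEFin; congr (_ * _)%E.
  by apply: eq_bigr => i _; exact: (probE i D (x, y)).
apply: cvg_EFin.
  by apply: nearW => n; rewrite /= FnE.
by apply: eq_cvgW cl => n; rewrite /= FnE.
Qed.

Theorem theorem4p7 (R : realType) (a b : R) (f g : R -> R) (p : R)
    (P : probability Omega R) (A : set R) :
  a < b ->
  (forall x, x \in `[a, b] -> f x \in `[a, b]) ->
  (forall x, x \in `[a, b] -> g x \in `[a, b]) ->
  0 <= p <= 1 ->
  is_bernoulli_product p P ->
  finite_set A ->
  A `<=` `[a, b] ->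
  (forall x, x \in `[a, b] ->
     P [set w : Omega | A (trajectory f g w x n)] @[n --> \oo] --> 1%E) ->
  chaos_measure a b f g P = 0%E.
Proof.
move=> ab _ _ p01 HP finA Aab PA; rewrite /chaos_measure -[RHS]ereal_sup1.
congr ereal_sup.
have zero x y : x \in `[a, b] -> y \in `[a, b] ->
    (((b - a)^-1)%:E * \int[lebesgue_measure]_(t in `[0%R, (b - a)%R])
      (Fstar f g P x y t - Flow f g P x y t) = 0)%E.
  move=> xab yab; rewrite integral0_eq ?mule0// => t _.
  (* The common value of the upper and lower limits is the finite number [l], so their extended-real
     difference is 0. *)
  have [l /cvg_limn_einf_sup[low up]] :=
    cvg_Fn R a b f g p P A x y t p01 HP finA Aab PA xab yab.
  by rewrite /Fstar /Flow low up subee.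
apply/seteqP; split=> [_ [x [y [xab yab ->]]]|_ ->]; first exact: zero.
(* The pair (a, a) shows that 0 is attained: the supremum of an empty set would be [-oo]. *)
have aab : a \in `[a, b] by rewrite in_itv/= lexx ltW.
by exists a, a; split=> //; rewrite zero.
Qed.
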